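(* The $D_4^{(1)}$ system (defined in the context) has the following invariant divisors: if $\alpha_0=0$, then $f_0:=x-\eta$ is an invariant divisor; if $\alpha_1=0$, then $f_1:=x$ is; if $\alpha_2=0$, then $f_2:=z$ is; if $\alpha_3=0$, then $f_3:=y-1$ is; if $\alpha_4=0$, then $f_4:=y$ is.
   Context: A polynomial $f$ in $x,y,z$ is an invariant divisor of a polynomial system if the derivative $df/dt$ along the system equals $f$ times a polynomial in $x,y,z$ (with coefficients in $\mathbb{C}(t)$). The $D_4^{(1)}$ system. Let $\eta\in\mathbb{C}\setminus\{0\}$, let $b(t)\in\mathbb{C}(t)$ be nonzero, and let $\alpha_0,\dots,\alpha_4\in\mathbb{C}$ satisfy $\alpha_0+\alpha_1+2\alpha_2+\alpha_3+\alpha_4=1$. The $D_4^{(1)}$ system for unknown functions $x,y,z$ of $t$ is $$\frac{2\eta}{b(t)}\frac{dx}{dt}=P,\qquad -\frac{2\eta}{b(t)}\frac{dy}{dt}=Q,\qquad \frac{2\eta}{b(t)}\frac{dz}{dt}=R,$$ where $P=-2x(y-1)yz(x-\eta)(2x-2y+1-\eta)-2(2\alpha_0+2\alpha_1+4\alpha_2+\alpha_3+\alpha_4)x^3y-2(\alpha_0+\alpha_1)xy^3+(5\alpha_0+5\alpha_1+6\alpha_2+\alpha_3+\alpha_4)x^2y^2-\{5\alpha_0+5\alpha_1+6\alpha_2+2\alpha_3-3(2\alpha_0+2\alpha_1+4\alpha_2+\alpha_3+\alpha_4)\eta\}x^2y+\{3(\alpha_0+\alpha_1)-(4\alpha_0+6\alpha_1+6\alpha_2+\alpha_3+\alpha_4)\eta\}xy^2+x^4+2(\alpha_0+\alpha_1+2\alpha_2+\alpha_3-\eta)x^3+2\alpha_1\eta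 y^3+\{(\alpha_0+\alpha_1+2\alpha_2+\alpha_3)(\eta^2-3\eta+1)+\alpha_4\eta^2\}x^2+\alpha_1(\eta-3)\eta y^2+\{-(\alpha_0+\alpha_1)+2(2\alpha_0+3\alpha_1+3\alpha_2+\alpha_3)\eta-(2\alpha_0+2\alpha_1+4\alpha_2+\alpha_3+\alpha_4)\eta^2\}xy+(\alpha_0+\alpha_1+2\alpha_2+\alpha_3)(\eta-1)\eta x-\alpha_1(\eta-1)\eta y$, $Q=2x(y-1)yz(x-\eta)(2x-2y+1-\eta)-2(\alpha_3+\alpha_4)x^3y-2(\alpha_0+\alpha_1+4\alpha_2+2\alpha_3+2\alpha_4)xy^3+(\alpha_0+\alpha_1+6\alpha_2+5\alpha_3+5\alpha_4)x^2y^2+\{-(\alpha_0+\alpha_1+6\alpha_2+4\alpha_3+6\alpha_4)+3(\alpha_3+\alpha_4)\eta\}x^2y+\{3(\alpha_0+\alpha_1+4\alpha_2+2\alpha_3+2\alpha_4)-(2\alpha_0+6\alpha_2+5\alpha_3+5\alpha_4)\eta\}xy^2+y^4+2\alpha_4x^3+2\{(\alpha_0+2\alpha_2+\alpha_3+\alpha_4)\eta-1\}y^3-\alpha_4(3\eta-1)x^2+\{1-3(\alpha_0+2\alpha_2+\alpha_3+\alpha_4)\eta+(\alpha_0+2\alpha_2+\alpha_3+\alpha_4)\eta^2\}y^2+\{-(\alpha_0+\alpha_1+4\alpha_2+2\alpha_3+2\alpha_4)+2(\alpha_0+3\alpha_2+2\alpha_3+3\alpha_4)\eta-(\alpha_3+\alpha_4)\eta^2\}xy+\alpha_4(\eta-1)\eta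 x-(\alpha_0+2\alpha_2+\alpha_3+\alpha_4)(\eta-1)\eta y$, $R=(2x-2y+1-\eta)\{2x^2y+2xy^2-x^2-\eta y^2-2(\eta+1)xy+\eta(x+y)\}z^2+z\big[-2(\alpha_3+\alpha_4)x^3+2(\alpha_0+\alpha_1)y^3+2(\alpha_0+\alpha_1+6\alpha_2+2\alpha_3+2\alpha_4)x^2y-2(2\alpha_0+2\alpha_1+6\alpha_2+\alpha_3+\alpha_4)xy^2+\{-(\alpha_0+\alpha_1+6\alpha_2+4\alpha_3)+3(\alpha_3+\alpha_4)\eta\}x^2+\{-3(\alpha_0+\alpha_1)+(4\alpha_0+6\alpha_2+\alpha_3+\alpha_4)\eta\}y^2-4\{-(\alpha_0+\alpha_1+3\alpha_2+\alpha_3)+(\alpha_0+3\alpha_2+\alpha_3+\alpha_4)\eta\}xy+\{-(\alpha_0+\alpha_1+4\alpha_2+2\alpha_3)+2(\alpha_0+3\alpha_2+2\alpha_3)\eta-(\alpha_3+\alpha_4)\eta^2\}x+\{\alpha_0+\alpha_1-2(2\alpha_0+3\alpha_2+\alpha_3)\eta+(2\alpha_0+4\alpha_2+\alpha_3+\alpha_4)\eta^2\}y-(\alpha_0+2\alpha_2+\alpha_3)(\eta-1)\eta\big]+\alpha_2\big[(\alpha_0+\alpha_1+2\alpha_2-\alpha_3-\alpha_4)x^2+(\alpha_0+\alpha_1-2\alpha_2-\alpha_3-\alpha_4)y^2-2(\alpha_0+\alpha_1-\alpha_3-\alpha_4)xy+\{\alpha_0+\alpha_1-2\alpha_3-(2\alpha_0+2\alpha_2-\alpha_3-\alpha_4)\eta\}x+\{-\alpha_0-\alpha_1+2\alpha_2+2\alpha_3+(2\alpha_0-\alpha_3-\alpha_4)\eta\}y+(\eta-1)(\alpha_2+\alpha_3+(\alpha_0+\alpha_2)\eta)\big]$.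 *)

(* Defs.v *)
From HB Require Import structures.
From mathcomp Require Import all_boot all_order all_algebra.
From mathcomp Require Export fraction.
From mathcomp Require Import generic_quotient ring.
From mathcomp Require Export reals complex mpoly.

Set Implicit Arguments.
Unset Strict Implicit.
Unset Printing Implicit Defensive.

Import GRing.Theory.
Local Open Scope ring_scope.
Local Open Scope quotient_scope.

Local Notation "p %:F" := (FracField.tofrac p) : ring_scope.

(* F(t) with its derivation d/dt.  [ratderiv] applies the quotient rule to the *)
(* canonical representative; [ratderivE] shows that any numerator and          *)
(* denominator give the same result.                                           *)
Section RationalFunctions.
Variable F : fieldType.

Local Notation ratfun := {fraction {poly F}}.

Definition ratconst (c : F) : ratfun := (c%:P)%:F.

Definition ratderiv (u : ratfun) : ratfun :=
  let p := \n_(repr u) in let q := \d_(repr u) in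
  (p^`() * q - p * q^`())%:F / (q ^+ 2)%:F.

Lemma ratfun_numden (u : ratfun) : u = (\n_(repr u))%:F / (\d_(repr u))%:F.
Proof.
have d0 : (\d_(repr u))%:F != 0 :> {fraction {poly F}}.
  by rewrite tofrac_eq0 denom_ratioP.
apply: (mulIf d0); rewrite divfK //.
set r := repr u in d0 *; rewrite -[u]reprK -/r.
unlock FracField.tofrac; rewrite -[LHS]FracField.pi_mul.
apply/eqmodP; rewrite /= FracField.equivfE /FracField.mulf.
rewrite !numden_Ratio ?mulf_neq0 ?oner_eq0 ?denom_ratioP //.
by rewrite !mulr1 mulrC.
Qed.

Lemma ratderivE (p q : {poly F}) : q != 0 ->
  ratderiv (p%:F / q%:F) = (p^`() * q - p * q^`())%:F / (q ^+ 2)%:F.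
Proof.
move=> q0; rewrite /ratderiv.
have := ratfun_numden (p%:F / q%:F).
have : \d_(repr (p%:F / q%:F : ratfun)) != 0 by exact: denom_ratioP.
move: (\n_(repr _)) (\d_(repr _)) => r s s0.
have q0' : q%:F != 0 :> ratfun by rewrite tofrac_eq0.
have s0' : s%:F != 0 :> ratfun by rewrite tofrac_eq0.
move/eqP; rewrite (eqr_div _ _ q0' s0') -!tofracM tofrac_eq => /eqP e.
have de : p^`() * s + p * s^`() = r^`() * q + r * q^`().
  by rewrite -!derivM e.
apply/eqP; rewrite eqr_div ?tofrac_eq0 ?expf_neq0 // -!tofracM tofrac_eq.
apply/eqP.
have -> : (r^`() * s - r * s^`()) * q ^+ 2
  = s * (r^`() * q) * q - s^`() * (r * q) * q by ring.
have -> : r^`() * q = p^`() * s + p * s^`() - r * q^`() by rewrite de; ring.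
rewrite -e.
have -> : s * (p^`() * s + p * s^`() - r * q^`()) * q - s^`() * (p * s) * q
  = s ^+ 2 * p^`() * q - s * q^`() * (r * q) by ring.
by rewrite -e; ring.
Qed.

Lemma quotient_rule_sub (K : fieldType) (p p' q q' r r' s s' : K) :
  q != 0 -> s != 0 ->
  ((p' * s + p * s' - (r' * q + r * q')) * (q * s)
     - (p * s - r * q) * (q' * s + q * s')) / (q * s * (q * s))
  = (p' * q - p * q') / (q * q) - (r' * s - r * s') / (s * s).
Proof. by move=> q0 s0; field; rewrite q0 s0. Qed.

Lemma ratderiv_is_zmod_morphism : zmod_morphism ratderiv.
Proof.
move=> u v; rewrite (ratfun_numden u) (ratfun_numden v).
have : \d_(repr u) != 0 by exact: denom_ratioP.
have : \d_(repr v) != 0 by exact: denom_ratioP.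
move: (\n_(repr u)) (\d_(repr u)) (\n_(repr v)) (\d_(repr v)).
move=> p q r s s0 q0.
have q0' : q%:F != 0 :> {fraction {poly F}} by rewrite tofrac_eq0.
have s0' : s%:F != 0 :> {fraction {poly F}} by rewrite tofrac_eq0.
have -> : p%:F / q%:F - r%:F / s%:F = (p * s - r * q)%:F / (q * s)%:F :> ratfun.
  by rewrite -mulNr (addf_div _ _ q0' s0') mulNr tofracB !tofracM.
have qs0 : q * s != 0 by rewrite mulf_neq0.
rewrite (ratderivE _ qs0) (ratderivE _ q0) (ratderivE _ s0) derivB !derivM.
rewrite !expr2 !(tofracB, tofracD, tofracM).
exact (quotient_rule_sub _ _ _ _ _ _ q0' s0').
Qed.

HB.instance Definition _ :=
  GRing.isZmodMorphism.Build ratfun ratfun ratderiv ratderiv_is_zmod_morphism.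

Lemma ratderiv_const (c : F) : ratderiv (ratconst c) = 0.
Proof.
have -> : ratconst c = c%:P%:F / 1%:F by rewrite tofrac1 divr1.
by rewrite (ratderivE _ (oner_neq0 _)) !derivC mul0r mulr0 subrr tofrac0 mul0r.
Qed.

End RationalFunctions.

(* The derivative of [f] along x_i' = v_i: [d] differentiates the coefficients. *)
Definition flowderiv (K : comNzRingType) (n : nat) (d : K -> K)
    (v : 'I_n -> {mpoly K[n]}) (f : {mpoly K[n]}) : {mpoly K[n]} :=
  map_mpoly d f + \sum_(i < n) f^`M(i) * v i.

Lemma flowderivX (K : comNzRingType) (n : nat) (d : {additive K -> K})
    (v : 'I_n -> {mpoly K[n]}) (i : 'I_n) : d 1 = 0 -> flowderiv d v 'X_i = v i.
Proof.
move=> d1; rewrite /flowderiv.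
have -> : map_mpoly d 'X_i = 0 :> {mpoly K[n]}.
  apply/mpolyP => m; rewrite mcoeff_map_mpoly mcoeffX mcoeff0.
  by case: eqP; rewrite ?d1 ?raddf0.
rewrite add0r (bigD1 i) //= big1 => [|j jNi].
  rewrite mderivX mnm1E eqxx scale1r addr0.
  have -> : (U_(i) - U_(i))%MM = 0%MM by apply/mnmP => k; rewrite mnmBE subnn mnm0E.
  by rewrite mpolyX0 mul1r.
by rewrite mderivX mnm1E eq_sym (negPf jNi) scale0r mul0r.
Qed.

Definition invariant_divisor (A : comNzRingType) (D : A -> A) (f : A) : Prop :=
  exists g : A, D f = f * g.

Section D4RightHandSides.
Variables (A : comPzRingType) (eta a0 a1 a2 a3 a4 x y z : A).

Definition D4P : A :=
  - 2 * x * (y - 1) * y * z * (x - eta) * (2 * x - 2 * y + 1 - eta)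
  - 2 * (2 * a0 + 2 * a1 + 4 * a2 + a3 + a4) * x ^+ 3 * y
  - 2 * (a0 + a1) * x * y ^+ 3
  + (5 * a0 + 5 * a1 + 6 * a2 + a3 + a4) * x ^+ 2 * y ^+ 2
  - (5 * a0 + 5 * a1 + 6 * a2 + 2 * a3
     - 3 * (2 * a0 + 2 * a1 + 4 * a2 + a3 + a4) * eta) * x ^+ 2 * y
  + (3 * (a0 + a1) - (4 * a0 + 6 * a1 + 6 * a2 + a3 + a4) * eta) * x * y ^+ 2
  + x ^+ 4
  + 2 * (a0 + a1 + 2 * a2 + a3 - eta) * x ^+ 3
  + 2 * a1 * eta * y ^+ 3
  + ((a0 + a1 + 2 * a2 + a3) * (eta ^+ 2 - 3 * eta + 1) + a4 * eta ^+ 2)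
    * x ^+ 2
  + a1 * (eta - 3) * eta * y ^+ 2
  + (- (a0 + a1) + 2 * (2 * a0 + 3 * a1 + 3 * a2 + a3) * eta
     - (2 * a0 + 2 * a1 + 4 * a2 + a3 + a4) * eta ^+ 2) * x * y
  + (a0 + a1 + 2 * a2 + a3) * (eta - 1) * eta * x
  - a1 * (eta - 1) * eta * y.

Definition D4Q : A :=
  2 * x * (y - 1) * y * z * (x - eta) * (2 * x - 2 * y + 1 - eta)
  - 2 * (a3 + a4) * x ^+ 3 * y
  - 2 * (a0 + a1 + 4 * a2 + 2 * a3 + 2 * a4) * x * y ^+ 3
  + (a0 + a1 + 6 * a2 + 5 * a3 + 5 * a4) * x ^+ 2 * y ^+ 2
  + (- (a0 + a1 + 6 * a2 + 4 * a3 + 6 * a4) + 3 * (a3 + a4) * eta)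
    * x ^+ 2 * y
  + (3 * (a0 + a1 + 4 * a2 + 2 * a3 + 2 * a4)
     - (2 * a0 + 6 * a2 + 5 * a3 + 5 * a4) * eta) * x * y ^+ 2
  + y ^+ 4
  + 2 * a4 * x ^+ 3
  + 2 * ((a0 + 2 * a2 + a3 + a4) * eta - 1) * y ^+ 3
  - a4 * (3 * eta - 1) * x ^+ 2
  + (1 - 3 * (a0 + 2 * a2 + a3 + a4) * eta
     + (a0 + 2 * a2 + a3 + a4) * eta ^+ 2) * y ^+ 2
  + (- (a0 + a1 + 4 * a2 + 2 * a3 + 2 * a4)
     + 2 * (a0 + 3 * a2 + 2 * a3 + 3 * a4) * eta
     - (a3 + a4) * eta ^+ 2) * x * y
  + a4 * (eta - 1) * eta * x
  - (a0 + 2 * a2 + a3 + a4) * (eta - 1) * eta * y.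

Definition D4R : A :=
  (2 * x - 2 * y + 1 - eta)
  * (2 * x ^+ 2 * y + 2 * x * y ^+ 2 - x ^+ 2 - eta * y ^+ 2
     - 2 * (eta + 1) * x * y + eta * (x + y)) * z ^+ 2
  + z * (
      - 2 * (a3 + a4) * x ^+ 3
      + 2 * (a0 + a1) * y ^+ 3
      + 2 * (a0 + a1 + 6 * a2 + 2 * a3 + 2 * a4) * x ^+ 2 * y
      - 2 * (2 * a0 + 2 * a1 + 6 * a2 + a3 + a4) * x * y ^+ 2
      + (- (a0 + a1 + 6 * a2 + 4 * a3) + 3 * (a3 + a4) * eta) * x ^+ 2
      + (- 3 * (a0 + a1) + (4 * a0 + 6 * a2 + a3 + a4) * eta) * y ^+ 2
      - 4 * (- (a0 + a1 + 3 * a2 + a3) + (a0 + 3 * a2 + a3 + a4) * eta)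
        * x * y
      + (- (a0 + a1 + 4 * a2 + 2 * a3) + 2 * (a0 + 3 * a2 + 2 * a3) * eta
         - (a3 + a4) * eta ^+ 2) * x
      + (a0 + a1 - 2 * (2 * a0 + 3 * a2 + a3) * eta
         + (2 * a0 + 4 * a2 + a3 + a4) * eta ^+ 2) * y
      - (a0 + 2 * a2 + a3) * (eta - 1) * eta)
  + a2 * (
      (a0 + a1 + 2 * a2 - a3 - a4) * x ^+ 2
      + (a0 + a1 - 2 * a2 - a3 - a4) * y ^+ 2
      - 2 * (a0 + a1 - a3 - a4) * x * y
      + (a0 + a1 - 2 * a3 - (2 * a0 + 2 * a2 - a3 - a4) * eta) * x
      + (- a0 - a1 + 2 * a2 + 2 * a3 + (2 * a0 - a3 - a4) * eta) * y
      + (eta - 1) * (a2 + a3 + (a0 + a2) * eta)).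

End D4RightHandSides.

Lemma scale_inv (K : nzRingType) (V : lmodType K) (c s : K) (g : V) :
  c * s = 1 -> c *: (s *: g) = g.
Proof. by move=> cs; rewrite scalerA cs scale1r. Qed.

Lemma scale_invN (K : nzRingType) (V : lmodType K) (c s : K) (g : V) :
  c * s = 1 -> - c *: (- s *: g) = g.
Proof. by move=> cs; rewrite scalerA mulrNN cs scale1r. Qed.

Section D4System.
Variable R : realType.

(* C(t) and C(t)[x, y, z] *)
Local Notation Ct := {fraction {poly R[i]}}.
Local Notation Cxyz := {mpoly Ct[3]}.

Definition cst (c : R[i]) : Cxyz := (ratconst c)%:MP.

Definition varx : Cxyz := 'X_(inord 0).
Definition vary : Cxyz := 'X_(inord 1).
Definition varz : Cxyz := 'X_(inord 2).

(* The system solved for the derivatives: (x', y', z') = b / (2 eta) (P, -Q, R), *)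
(* see [D4systemE].                                                             *)
Definition D4field (eta a0 a1 a2 a3 a4 : R[i]) (b : Ct) (i : 'I_3) : Cxyz :=
  let s := b / (2 * ratconst eta) in
  let rhs F := F (cst eta) (cst a0) (cst a1) (cst a2) (cst a3) (cst a4)
                 varx vary varz in
  [:: s *: rhs (@D4P Cxyz); - s *: rhs (@D4Q Cxyz); s *: rhs (@D4R Cxyz)]`_i.

Definition D4deriv (eta a0 a1 a2 a3 a4 : R[i]) (b : Ct) : Cxyz -> Cxyz :=
  flowderiv (@ratderiv R[i]) (D4field eta a0 a1 a2 a3 a4 b).

Lemma D4systemE (eta a0 a1 a2 a3 a4 : R[i]) (b : Ct) :
  eta != 0 -> b != 0 ->
  let rhs F := F (cst eta) (cst a0) (cst a1) (cst a2) (cst a3) (cst a4)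
                 varx vary varz in
  let D := D4deriv eta a0 a1 a2 a3 a4 b in
  let c := 2 * ratconst eta / b in
  [/\ c *: D varx = rhs (@D4P Cxyz),
      - c *: D vary = rhs (@D4Q Cxyz)
    & c *: D varz = rhs (@D4R Cxyz)].
Proof.
move=> eta0 b0 rhs D c.
have e0 : 2 * ratconst eta != 0 :> Ct.
  have -> : 2 * ratconst eta = ratconst (2 * eta).
    by rewrite /ratconst polyCM tofracM polyC_natr rmorph_nat.
  rewrite /ratconst tofrac_eq0 polyC_eq0 mulf_eq0 negb_or eta0 andbT.
  by rewrite Num.Theory.pnatr_eq0.
have DX (i : 'I_3) : D 'X_i = D4field eta a0 a1 a2 a3 a4 b i.
  by apply: flowderivX; rewrite -(ratderiv_const 1) /ratconst tofrac1.
have cs : c * (b / (2 * ratconst eta)) = 1.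
  by rewrite /c mulrA (divfK b0) (mulfV e0).
split.
- rewrite /varx DX /D4field inordK //; exact (scale_inv _ cs).
- rewrite /vary DX /D4field inordK //; exact (scale_invN _ cs).
- rewrite /varz DX /D4field inordK //; exact (scale_inv _ cs).
Qed.

End D4System.

(* Main.v *)
From HB Require Import structures.
Require Import Defs.
From mathcomp Require Import all_boot all_order all_algebra.
From mathcomp Require Import fraction reals complex mpoly.
From mathcomp Require Import ring.

Set Implicit Arguments.
Unset Strict Implicit.

Import GRing.Theory.
Local Open Scope ring_scope.

(** Each divisor has the form [u - c], where [u] is one of the unknowns and [c]
    is a constant: [c = eta] or [0] for [x], [0] for [z], [1] or [0] for [y].
    The derivative along the system kills constants, so the derivative of
    [u - c] is the equation of [u], a scalar multiple of [P], [Q] or [R].  Read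
    that right-hand side as a polynomial in [u] alone, with the two other
    unknowns among the coefficients.  By the factor theorem it is a multiple of
    [u - c] as soon as it vanishes at [u = c] ([horner_root_dvd]), so no
    cofactor has to be written down.

    What is left is to evaluate [P], [Q] and [R] on the five hyperplanes.  On
    [x = 0], [y = 0] and [z = 0] every term of the right-hand side has the factor
    [a1], [a4] or [a2], or the unknown itself.  On [y = 1], with [a3 = 0], each
    power of [x] has coefficient [0].  On [x = eta], with [a0 = 0], the terms
    with [y] cancel as well, and the others add up to
    [(a1 + 2 * a2 + a3 + a4 - 1) * eta ^+ 4]: the term [-1] comes from
    [x ^+ 4 - 2 * eta * x ^+ 3], and the normalisation
    [a0 + a1 + 2 * a2 + a3 + a4 = 1] makes the sum vanish. *)

(** * The derivative along a vector field *)

Section FlowDerivative.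
Variables (K : comNzRingType) (n : nat) (d : {additive K -> K}).
Variable v : 'I_n -> {mpoly K[n]}.

Lemma flowderivB (f g : {mpoly K[n]}) :
  flowderiv d v (f - g) = flowderiv d v f - flowderiv d v g.
Proof.
rewrite /flowderiv raddfB /= opprD addrACA -sumrB; congr (_ + _).
by apply: eq_bigr => i _; rewrite mderivB mulrBl.
Qed.

Lemma flowderivC (c : K) : d c = 0 -> flowderiv d v c%:MP = 0.
Proof.
move=> dc; rewrite /flowderiv big1 => [|i _]; last by rewrite mderivC mul0r.
apply/mpolyP => m; rewrite addr0 mcoeff_map_mpoly mcoeffC mcoeff0.
by case: eqP; rewrite ?mulr1 ?mulr0 ?dc ?raddf0.
Qed.

End FlowDerivative.

Lemma horner_root_dvd (A : comNzRingType) (p : {poly A}) (u c : A) :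
  p.[c] = 0 -> exists g, p.[u] = (u - c) * g.
Proof.
move=> /rootP /factor_theorem [q ->]; exists q.[u].
by rewrite hornerM hornerXsubC mulrC.
Qed.

(** * The right-hand sides on the five hyperplanes *)

(** [P], [Q] and [R] commute with ring morphisms; hence they can be formed over
    [{poly A}], with one unknown replaced by ['X], and then evaluated. *)
Section Morphisms.
Variables (A B : comNzRingType) (f : {rmorphism A -> B}).
Variables eta a0 a1 a2 a3 a4 x y z : A.

Lemma rmorph_D4P : f (D4P eta a0 a1 a2 a3 a4 x y z)
  = D4P (f eta) (f a0) (f a1) (f a2) (f a3) (f a4) (f x) (f y) (f z).
Proof. by rewrite /D4P; ring. Qed.

Lemma rmorph_D4Q : f (D4Q eta a0 a1 a2 a3 a4 x y z)
  = D4Q (f eta) (f a0) (f a1) (f a2) (f a3) (f a4) (f x) (f y) (f z).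
Proof. by rewrite /D4Q; ring. Qed.

Lemma rmorph_D4R : f (D4R eta a0 a1 a2 a3 a4 x y z)
  = D4R (f eta) (f a0) (f a1) (f a2) (f a3) (f a4) (f x) (f y) (f z).
Proof. by rewrite /D4R; ring. Qed.

Lemma rmorph_sum1 : a0 + a1 + 2 * a2 + a3 + a4 = 1 ->
  f a0 + f a1 + 2 * f a2 + f a3 + f a4 = 1.
Proof.
by move=> h; rewrite -[RHS](rmorph1 f) -h !rmorphD rmorphM rmorph_nat.
Qed.

End Morphisms.

Section Divisibility.
Variables (A : comNzRingType) (eta a0 a1 a2 a3 a4 x y z : A).

Lemma D4P_dvd (c : A) : D4P eta a0 a1 a2 a3 a4 c y z = 0 ->
  exists g, D4P eta a0 a1 a2 a3 a4 x y z = (x - c) * g.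
Proof.
pose p := D4P eta%:P a0%:P a1%:P a2%:P a3%:P a4%:P 'X y%:P z%:P.
have pE u : p.[u] = D4P eta a0 a1 a2 a3 a4 u y z.
  by rewrite -[LHS]/(horner_eval u p) rmorph_D4P /= /horner_eval hornerX !hornerC.
by rewrite -!pE; apply: horner_root_dvd.
Qed.

Lemma D4Q_dvd (c : A) : D4Q eta a0 a1 a2 a3 a4 x c z = 0 ->
  exists g, D4Q eta a0 a1 a2 a3 a4 x y z = (y - c) * g.
Proof.
pose p := D4Q eta%:P a0%:P a1%:P a2%:P a3%:P a4%:P x%:P 'X z%:P.
have pE u : p.[u] = D4Q eta a0 a1 a2 a3 a4 x u z.
  by rewrite -[LHS]/(horner_eval u p) rmorph_D4Q /= /horner_eval hornerX !hornerC.
by rewrite -!pE; apply: horner_root_dvd.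
Qed.

Lemma D4R_dvd (c : A) : D4R eta a0 a1 a2 a3 a4 x y c = 0 ->
  exists g, D4R eta a0 a1 a2 a3 a4 x y z = (z - c) * g.
Proof.
pose p := D4R eta%:P a0%:P a1%:P a2%:P a3%:P a4%:P x%:P y%:P 'X.
have pE u : p.[u] = D4R eta a0 a1 a2 a3 a4 x y u.
  by rewrite -[LHS]/(horner_eval u p) rmorph_D4R /= /horner_eval hornerX !hornerC.
by rewrite -!pE; apply: horner_root_dvd.
Qed.

Lemma D4P_eta : a0 + a1 + 2 * a2 + a3 + a4 = 1 -> a0 = 0 ->
  D4P eta a0 a1 a2 a3 a4 eta y z = 0.
Proof.
move=> asum a00; have a4E : a4 = 1 - (a0 + a1 + 2 * a2 + a3).
  by apply: (canRL (addrK _)); rewrite addrC.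
by rewrite a4E a00 /D4P; ring.
Qed.

Lemma D4P_0 : a1 = 0 -> D4P eta a0 a1 a2 a3 a4 0 y z = 0.
Proof. by move=> ->; rewrite /D4P; ring. Qed.

Lemma D4R_0 : a2 = 0 -> D4R eta a0 a1 a2 a3 a4 x y 0 = 0.
Proof. by move=> ->; rewrite /D4R; ring. Qed.

Lemma D4Q_1 : a3 = 0 -> D4Q eta a0 a1 a2 a3 a4 x 1 z = 0.
Proof. by move=> ->; rewrite /D4Q; ring. Qed.

Lemma D4Q_0 : a4 = 0 -> D4Q eta a0 a1 a2 a3 a4 x 0 z = 0.
Proof. by move=> ->; rewrite /D4Q; ring. Qed.

End Divisibility.

(** * Invariant divisors of the system *)

(** Of the field of rational functions in [t] only this much enters: a ring
    with an additive map that kills [1] and [eta].  In the system, the factors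
    [s], [t] and [r] are [b / (2 * eta)], its opposite and again
    [b / (2 * eta)]. *)
Section InvariantDivisors.
Variables (K : comNzRingType) (d : {additive K -> K}) (v : 'I_3 -> {mpoly K[3]}).
Variables eta a0 a1 a2 a3 a4 s t r : K.

Local Notation x := ('X_(inord 0) : {mpoly K[3]}).
Local Notation y := ('X_(inord 1) : {mpoly K[3]}).
Local Notation z := ('X_(inord 2) : {mpoly K[3]}).
Local Notation rhs F := (F eta%:MP a0%:MP a1%:MP a2%:MP a3%:MP a4%:MP x y z).

Hypothesis asum : a0 + a1 + 2 * a2 + a3 + a4 = 1.
Hypotheses (d1 : d 1 = 0) (deta : d eta = 0).
Hypothesis vx : v (inord 0) = s *: rhs (@D4P _).
Hypothesis vy : v (inord 1) = t *: rhs (@D4Q _).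
Hypothesis vz : v (inord 2) = r *: rhs (@D4R _).

Lemma invariant_divisor_sub_const i c k w :
  d c = 0 -> v i = k *: w -> (exists g, w = ('X_i - c%:MP) * g) ->
  invariant_divisor (flowderiv d v) ('X_i - c%:MP).
Proof.
move=> dc vi [g wE]; exists (k *: g).
by rewrite flowderivB (flowderivX _ _ d1) (flowderivC _ dc) subr0 vi wE scalerAr.
Qed.

Lemma D4_invariant_divisors :
  let invdiv := invariant_divisor (flowderiv d v) in
  [/\ a0 = 0 -> invdiv (x - eta%:MP), a1 = 0 -> invdiv x, a2 = 0 -> invdiv z,
      a3 = 0 -> invdiv (y - 1) & a4 = 0 -> invdiv y].
Proof.
move=> invdiv.
have d0 : d 0 = 0 by exact: raddf0.
have asum' := rmorph_sum1 (@mpolyC 3 K) asum.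
have a_eq0 (a : K) : a = 0 -> a%:MP = 0 :> {mpoly K[3]}.
  by move=> ->; exact: mpolyC0.
(* The unknowns themselves are put in the form ['X_i - c%:MP]. *)
have sub0 (u : {mpoly K[3]}) : u - 0%:MP = u by rewrite mpolyC0 subr0.
split=> /a_eq0 h.
- by apply: (invariant_divisor_sub_const deta vx); apply/D4P_dvd/D4P_eta.
- rewrite -[x]sub0; apply: (invariant_divisor_sub_const d0 vx).
  by rewrite mpolyC0; apply/D4P_dvd/D4P_0.
- rewrite -[z]sub0; apply: (invariant_divisor_sub_const d0 vz).
  by rewrite mpolyC0; apply/D4R_dvd/D4R_0.
- rewrite -mpolyC1; apply: (invariant_divisor_sub_const d1 vy).
  by rewrite mpolyC1; apply/D4Q_dvd/D4Q_1.
- rewrite -[y]sub0; apply: (invariant_divisor_sub_const d0 vy).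
  by rewrite mpolyC0; apply/D4Q_dvd/D4Q_0.
Qed.

End InvariantDivisors.

Section Constants.
Variable F : fieldType.

Lemma ratconst_is_zmod_morphism : zmod_morphism (@ratconst F).
Proof. by move=> c e; rewrite /ratconst polyCB tofracB. Qed.

Lemma ratconst_is_monoid_morphism : monoid_morphism (@ratconst F).
Proof.
by split=> [|c e]; rewrite /ratconst ?polyC1 ?tofrac1 // polyCM tofracM.
Qed.

HB.instance Definition _ :=
  GRing.isZmodMorphism.Build _ _ (@ratconst F) ratconst_is_zmod_morphism.
HB.instance Definition _ :=
  GRing.isMonoidMorphism.Build _ _ (@ratconst F) ratconst_is_monoid_morphism.

Lemma ratderiv1 : ratderiv (1 : {fraction {poly F}}) = 0.
Proof. by rewrite -(rmorph1 (@ratconst F)) ratderiv_const. Qed.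

Lemma ratconst_eq0 (c : F) : c = 0 -> ratconst c = 0.
Proof. by move=> ->; exact: rmorph0. Qed.

Lemma ratconst_sum1 (a0 a1 a2 a3 a4 : F) : a0 + a1 + 2 * a2 + a3 + a4 = 1 ->
  ratconst a0 + ratconst a1 + 2 * ratconst a2 + ratconst a3 + ratconst a4 = 1.
Proof. exact: rmorph_sum1. Qed.

End Constants.

Unset Implicit Arguments.
Set Strict Implicit.

Theorem proposition2p3 (R : realType) (eta : R[i]) (b : {fraction {poly R[i]}})
    (a0 a1 a2 a3 a4 : R[i]) (heta : eta <> 0) (hb : b <> 0)
    (hsum : a0 + a1 + 2 * a2 + a3 + a4 = 1) :
  let invdiv := invariant_divisor (D4deriv eta a0 a1 a2 a3 a4 b) in
  [/\ a0 = 0 -> invdiv (varx R - cst eta),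
      a1 = 0 -> invdiv (varx R),
      a2 = 0 -> invdiv (varz R),
      a3 = 0 -> invdiv (vary R - 1)
    & a4 = 0 -> invdiv (vary R)].
Proof.
(* Only the existence of a scalar factor matters for invariance. *)
have [s Ex] : exists s, D4field eta a0 a1 a2 a3 a4 b (inord 0)
    = s *: D4P (cst eta) (cst a0) (cst a1) (cst a2)
               (cst a3) (cst a4) (varx R) (vary R) (varz R).
  eexists; rewrite /D4field inordK; [reflexivity | by []].
have [t Ey] : exists s, D4field eta a0 a1 a2 a3 a4 b (inord 1)
    = s *: D4Q (cst eta) (cst a0) (cst a1) (cst a2)
               (cst a3) (cst a4) (varx R) (vary R) (varz R).
  eexists; rewrite /D4field inordK; [reflexivity | by []].
have [r Ez] : exists s, D4field eta a0 a1 a2 a3 a4 b (inord 2)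
    = s *: D4R (cst eta) (cst a0) (cst a1) (cst a2)
               (cst a3) (cst a4) (varx R) (vary R) (varz R).
  eexists; rewrite /D4field inordK; [reflexivity | by []].
have [d0 d1 d2 d3 d4] := D4_invariant_divisors (ratconst_sum1 hsum)
  (ratderiv1 _) (ratderiv_const eta) Ex Ey Ez.
by split=> /ratconst_eq0;
  [exact: d0 | exact: d1 | exact: d2 | exact: d3 | exact: d4].
Qed.
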